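(* Let $R$ be a rack. Then $\mathrm{Inn}(R)$ is an abelian group if and only if $R$ is a $P$-rack.
   Context: A rack is a set $R$ with a binary operation $\triangleright$ such that $a\triangleright(b\triangleright c)=(a\triangleright b)\triangleright(a\triangleright c)$ for all $a,b,c\in R$, and for all $a,b\in R$ there is a unique $x\in R$ with $a\triangleright x=b$. For $a\in R$, $f_a:R\to R$ is the bijection $f_a(b)=a\triangleright b$; $\mathrm{Inn}(R)$ is the group of permutations of $R$ generated by $\{f_a:a\in R\}$. A $P$-rack is a rack $(R,\triangleright)$ for which there exist a partition $\{R_i\}_{i\in I}$ of $R$ and a family $\{f_i\}_{i\in I}$ of permutations of $R$ with $f_i(R_j)=R_j$ and $f_if_j=f_jf_i$ for all $i,j\in I$, such that $x\triangleright y=f_i(y)$ for all $x,y\in R$ where $i$ is the index with $x\in R_i$. *)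

(* Defs.v *)
From HB Require Import structures.
From mathcomp Require Import all_boot.
From mathcomp Require Import boolp classical_sets.

Set Implicit Arguments.
Unset Strict Implicit.
Unset Printing Implicit Defensive.

Local Open Scope classical_set_scope.
Local Open Scope group_scope.

Declare Scope rack_scope.
Reserved Notation "a |> b" (at level 40, left associativity).

(* The permutations of an arbitrary, possibly infinite, type; [{perm T}] and
   the groups of [fingroup] exist only over a [finType]. *)
Record sym (T : Type) := Sym { sym_fun :> T -> T; sym_bij : bijective sym_fun }.

Section SymGroup.
Variable T : Type.
Implicit Types s t u : sym T.

Lemma symP s t : s =1 t -> s = t.
Proof.
case: s t => [f bf] [g bg] /= /funext fg.
by case: g / fg bg => bg; congr Sym; exact: Prop_irrelevance.
Qed.

Definition sym_one : sym T := Sym (Bijective (frefl id) (frefl id)).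

Definition sym_mul s t : sym T := Sym (bij_comp (sym_bij s) (sym_bij t)).

Lemma sym_inv_ex s : exists t, cancel s t /\ cancel t s.
Proof.
case: (sym_bij s) => g sg gs.
by exists (Sym (Bijective gs sg)).
Qed.

Definition sym_inv s : sym T := projT1 (cid (sym_inv_ex s)).

Lemma sym_invK s : cancel s (sym_inv s).
Proof. by rewrite /sym_inv; case: cid => t /= []. Qed.

Lemma sym_invVK s : cancel (sym_inv s) s.
Proof. by rewrite /sym_inv; case: cid => t /= []. Qed.

Lemma sym_mulA : associative sym_mul.
Proof. by move=> s t u; apply: symP. Qed.

Lemma sym_mul1 : left_id sym_one sym_mul.
Proof. by move=> s; apply: symP. Qed.

Lemma sym_mulr1 : right_id sym_one sym_mul.
Proof. by move=> s; apply: symP. Qed.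

Lemma sym_mulV : left_inverse sym_one sym_inv sym_mul.
Proof. by move=> s; apply: symP => x /=; rewrite sym_invK. Qed.

Lemma sym_mulrV : right_inverse sym_one sym_inv sym_mul.
Proof. by move=> s; apply: symP => x /=; rewrite sym_invVK. Qed.

HB.instance Definition _ := gen_eqMixin (sym T).
HB.instance Definition _ := gen_choiceMixin (sym T).
HB.instance Definition _ := isGroup.Build (sym T)
  sym_mulA sym_mul1 sym_mulr1 sym_mulV sym_mulrV.

End SymGroup.

Section Subgroups.
Variable G : groupType.
Implicit Types A H : set G.

Definition subgroup H := H 1 /\ forall x y, H x -> H y -> H (x / y).

Definition generated A : set G := smallest subgroup A.

Definition abelian_subgroup H :=
  subgroup H /\ forall x y, H x -> H y -> commute x y.

Lemma subgroup_generated A : subgroup (generated A).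
Proof.
split=> [H [[] //]|x y Ax Ay H HA].
by case: (HA) => -[_ HV] _; apply: HV; [exact: Ax | exact: Ay].
Qed.

End Subgroups.

HB.mixin Record isRack (R : Type) := {
  rack_op : R -> R -> R;
  rack_opD : forall a b c : R,
    rack_op a (rack_op b c) = rack_op (rack_op a b) (rack_op a c);
  rack_op_solve : forall a b : R, exists! x, rack_op a x = b
}.

#[short(type="rackType")]
HB.structure Definition Rack := {R of isRack R}.

Notation "a |> b" := (rack_op a b) : rack_scope.
Local Open Scope rack_scope.

Section RackTheory.
Variable R : rackType.

Lemma rack_op_bij (a : R) : bijective (rack_op a).
Proof.
have [g ga] : {g : R -> R & forall b, a |> g b = b}.
  by apply: (@choice _ _ (fun b x => a |> x = b)) => b;
    have [x [ax _]] := rack_op_solve a b; exists x.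
exists g => // x.
have [y [_ yP]] := rack_op_solve a (a |> x).
exact: etrans (esym (yP _ (ga _))) (yP x erefl).
Qed.

Definition ltrans (a : R) : sym R := Sym (rack_op_bij a).

Definition Inn : set (sym R) := generated (range ltrans).

Definition is_P_rack : Prop :=
  exists (I : Type) (P : I -> set R) (f : I -> sym R),
    [/\ partition [set: I] P [set: R],
        forall i j, f i @` P j = P j,
        forall i j, commute (f i) (f j) &
        forall i x y, P i x -> x |> y = f i y].

End RackTheory.

Arguments Inn : clear implicits.
Arguments is_P_rack : clear implicits.

(* Main.v *)
(* The inner permutations satisfy f_(a |> b) = f_a f_b f_a^-1, so if they commute
   then f_(a |> b) = f_b, that is, every f_a preserves the fibres of a |-> f_a,
   and these fibres form the required partition. *)
From mathcomp Require Import all_boot.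
From mathcomp Require Import boolp classical_sets.
Require Import Defs.

Set Implicit Arguments.
Unset Strict Implicit.
Unset Printing Implicit Defensive.

Local Open Scope classical_set_scope.
Local Open Scope group_scope.
Local Open Scope rack_scope.

Lemma sub_generated (G : groupType) (A : set G) : A `<=` generated A.
Proof. exact: sub_smallest. Qed.

Lemma generated_sub (G : groupType) (A H : set G) :
  subgroup H -> A `<=` H -> generated A `<=` H.
Proof. by move=> sgH AH; apply: smallest_sub. Qed.

Lemma subgroup_centralizer (G : groupType) (A : set G) :
  subgroup [set y : G | forall x, A x -> commute x y].
Proof.
split=> [x _|y z cy cz x Ax]; first exact: commute1.
by apply: commuteM; [exact: cy | apply: commuteV; exact: cz].
Qed.

(** The centralizer argument is applied twice. The centralizer of [A] is a subgroup containing [A],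
    so it contains [generated A]. Hence [A] lies in the centralizer of [generated A], and this
    subgroup then contains [generated A] too. *)
Lemma abelian_generated (G : groupType) (A : set G) :
  (forall x y, A x -> A y -> commute x y) -> abelian_subgroup (generated A).
Proof.
move=> cA; split; first exact: subgroup_generated.
have cent_gen : generated A `<=` [set y | forall x, A x -> commute x y].
  apply: generated_sub; first exact: subgroup_centralizer.
  by move=> y Ay x Ax; exact: cA.
move=> x y gx gy; move: y gy x gx; apply: generated_sub.
  exact: subgroup_centralizer.
by move=> y Ay x gx; apply/commute_sym/cent_gen.
Qed.

(** Self-distributivity read as an identity of permutations; the conjugation formula is kept free of
    inverses. *)
Lemma ltrans_op (R : rackType) (a b : R) :
  ltrans (a |> b) * ltrans a = ltrans a * ltrans b.
Proof. by apply: symP => c; exact/esym/rack_opD. Qed.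

Lemma ltrans_op_commute (R : rackType) (a b : R) :
  commute (ltrans a) (ltrans b) -> ltrans (a |> b) = ltrans b.
Proof. by move=> cab; apply: (mulIg (ltrans a)); rewrite ltrans_op; exact: cab. Qed.

Lemma abelian_Inn_is_P_rack (R : rackType) :
  (forall a b : R, commute (ltrans a) (ltrans b)) -> is_P_rack R.
Proof.
move=> cR.
(* The blocks are the fibres of [ltrans]; indexing them by the range of
   [ltrans] keeps them nonempty. *)
exists (set_type (range (@ltrans R))), (fun s => [set x | ltrans x = val s]),
  (fun s => val s).
split.
- split.
  + apply/seteqP; split=> // x _.
    have rx : range (@ltrans R) (ltrans x) by exists x.
    by exists (SigSub (mem_set rx)).
  + by move=> s t _ _ [x [/= xs xt]]; apply: val_inj; exact: etrans (esym xs) xt.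
  + by move=> [s /= /set_mem [x _ xs]] _; exists x.
- move=> [s /= /set_mem [a _ <-]] [t /= /set_mem _]; apply/seteqP; split.
  + by move=> _ [x /= <- <-]; exact: ltrans_op_commute.
  (* The preimage [x] of [y] under [ltrans a] stays in the fibre of [y], since
     [ltrans x = ltrans (a |> x) = ltrans y]. *)
  + move=> y /= yt; have [x [axy _]] := rack_op_solve a y.
    by exists x => //=; rewrite -yt -axy ltrans_op_commute.
- by move=> [s /= /set_mem [a _ <-]] [t /= /set_mem [b _ <-]]; exact: cR.
- by move=> s x y /= <-.
Qed.

Theorem theorem4p2 (R : rackType) :
  abelian_subgroup (Inn R) <-> is_P_rack R.
Proof.
split=> [[_ cI]|[I [P [f [[PT _ _] _ cf fP]]]]].
  by apply: abelian_Inn_is_P_rack => a b; apply: cI;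
    apply: sub_generated; exact: imageT.
apply: abelian_generated.
(* The blocks cover [R], so every generator of [Inn R] is one of the commuting permutations
   [f i]. *)
have ltransE a : exists i, ltrans a = f i.
  have : [set: R] a by [].
  rewrite -PT => -[i _ Pia]; exists i.
  by apply: symP => y; exact: fP.
move=> _ _ [a _ <-] [b _ <-].
by have [i ->] := ltransE a; have [j ->] := ltransE b; exact: cf.
Qed.
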